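(* Let $\mathcal{F}$ be convex, lower semi-continuous and separably $*$-increasing, with some $\pi\in\Pi(\mathbb{P},\mathbb{Q})$ satisfying $\mathcal{F}(\pi)<\infty$. Let $v^*\in\mathcal{C}(\mathcal{Y})$ be an optimal potential, i.e. $v^*\in\arg\sup_{v\in\mathcal{C}(\mathcal{Y})}\inf_{\pi\in\Pi(\mathbb{P})}\mathcal{L}(v,\pi)$. Then for every OT plan $\pi^*\in\Pi(\mathbb{P},\mathbb{Q})$ (i.e. every minimizer of $\mathcal{F}$ over $\Pi(\mathbb{P},\mathbb{Q})$) it holds that $\pi^*\in\arg\inf_{\pi\in\Pi(\mathbb{P})}\mathcal{L}(v^*,\pi)$.
   Context: Let $D\ge 1$ and let $\mathcal{X}=\mathcal{Y}\subset\mathbb{R}^D$ be compact; $\mathbb{P}\in\mathcal{P}(\mathcal{X})$, $\mathbb{Q}\in\mathcal{P}(\mathcal{Y})$. $\mathcal{C}(\mathcal{S})$ denotes continuous real functions, $\mathcal{M}(\mathcal{S})$ finite signed Borel measures, $\mathcal{P}(\mathcal{S})$ Borel probability measures; lower semi-continuity is w.r.t. the weak-$*$ topology. $\Pi(\mathbb{P})$: probability measures on $\mathcal{X}\times\mathcal{Y}$ with first marginal $\mathbb{P}$; $\Pi(\mathbb{P},\mathbb{Q})$: those with marginals $\mathbb{P},\mathbb{Q}$. $\mathcal{F}^*(h)=\sup_{\pi\in\mathcal{M}(\mathcal{X}\times\mathcal{Y})}[\int h\,d\pi-\mathcal{F}(\pi)]$. $\mathcal{F}$ is separably $*$-increasing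 if $u(x)+v(y)\le c(x,y)$ pointwise ($u\in\mathcal{C}(\mathcal{X}),v\in\mathcal{C}(\mathcal{Y}),c\in\mathcal{C}(\mathcal{X}\times\mathcal{Y})$) implies $\mathcal{F}^*(u\oplus v)\le\mathcal{F}^*(c)$, where $(u\oplus v)(x,y)=u(x)+v(y)$. $\mathrm{Cost}(\mathbb{P},\mathbb{Q})=\inf_{\pi\in\Pi(\mathbb{P},\mathbb{Q})}\mathcal{F}(\pi)$. For $v\in\mathcal{C}(\mathcal{Y})$, $\pi\in\Pi(\mathbb{P})$: $\mathcal{L}(v,\pi)=\mathcal{F}(\pi)-\int_{\mathcal{Y}}v\,d\pi_{\mathcal{Y}}+\int_{\mathcal{Y}}v\,d\mathbb{Q}$, $\pi_{\mathcal{Y}}$ the second marginal of $\pi$. *)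

(* Defs.v *)
From HB Require Import structures.
From mathcomp Require Import all_boot all_order all_algebra.
From mathcomp Require Import all_classical all_reals all_analysis.
Import Order.TTheory GRing.Theory Num.Theory numFieldNormedType.Exports.

Set Implicit Arguments.
Unset Strict Implicit.
Unset Printing Implicit Defensive.

Local Open Scope classical_set_scope.
Local Open Scope ring_scope.

Notation BX R D := (g_sigma_algebraType (@open 'rV[R]_D)).
Notation BXY R D := (g_sigma_algebraType (@open ('rV[R]_D * 'rV[R]_D)%type)).

(* Finite signed Borel measures on X x Y are represented as charges on       *)
(* R^D x R^D that are concentrated on X x Y (vanish on every measurable      *)
(* subset of the complement of X x Y).                                       *)
Definition inM (R : realType) (D : nat) (X Y : set 'rV[R]_D)
    (nu : {charge set BXY R D -> \bar R}) : Prop :=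
  forall A : set (BXY R D), measurable A -> A `<=` ~` (X `*` Y) -> nu A = 0%E.

(* A (chosen) Hahn decomposition of a charge; the Jordan decomposition does  *)
(* not depend on this choice.                                                *)
Definition hahn_of (R : realType) (D : nat) (nu : {charge set BXY R D -> \bar R})
  : sig (fun PN : set (BXY R D) * set (BXY R D) =>
           hahn_decomposition nu PN.1 PN.2).
Proof.
apply: cid.
have [P [N h]] := Hahn_decomposition nu.
by exists (P, N).
Defined.

Definition cint (R : realType) (D : nat) (nu : {charge set BXY R D -> \bar R})
    (A : set (BXY R D)) (h : 'rV[R]_D * 'rV[R]_D -> R) : \bar R :=
  (\int[jordan_pos (proj2_sig (hahn_of nu))]_(z in A) (h z)%:E
   - \int[jordan_neg (proj2_sig (hahn_of nu))]_(z in A) (h z)%:E)%E.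

Definition wstar_open (R : realType) (D : nat) (X Y : set 'rV[R]_D)
    (U : set ({charge set BXY R D -> \bar R})) : Prop :=
  forall nu, inM X Y nu -> U nu ->
  exists (n : nat) (hs : 'I_n -> 'rV[R]_D * 'rV[R]_D -> R) (e : R),
    [/\ 0 < e,
        (forall i, ({within X `*` Y, continuous (hs i)})) &
        forall nu', inM X Y nu' ->
          (forall i, (`| cint nu' (X `*` Y) (hs i) - cint nu (X `*` Y) (hs i) |
                       < e%:E)%E) ->
          U nu'].

Definition wstar_lsc (R : realType) (D : nat) (X Y : set 'rV[R]_D)
    (F : {charge set BXY R D -> \bar R} -> \bar R) : Prop :=
  forall c : R, wstar_open X Y [set nu | (c%:E < F nu)%E].

Definition convex_on_M (R : realType) (D : nat) (X Y : set 'rV[R]_D)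
    (F : {charge set BXY R D -> \bar R} -> \bar R) : Prop :=
  forall nu1 nu2, inM X Y nu1 -> inM X Y nu2 ->
  forall t : R, 0 < t < 1 ->
  (F (cadd (cscale t nu1) (cscale (1 - t) nu2))
     <= t%:E * F nu1 + (1 - t)%:E * F nu2)%E.

Definition Fstar (R : realType) (D : nat) (X Y : set 'rV[R]_D)
    (F : {charge set BXY R D -> \bar R} -> \bar R)
    (h : 'rV[R]_D * 'rV[R]_D -> R) : \bar R :=
  ereal_sup [set (cint nu (X `*` Y) h - F nu)%E | nu in [set nu | inM X Y nu]].

Definition sep_star_increasing (R : realType) (D : nat) (X Y : set 'rV[R]_D)
    (F : {charge set BXY R D -> \bar R} -> \bar R) : Prop :=
  forall (u v : 'rV[R]_D -> R) (c : 'rV[R]_D * 'rV[R]_D -> R),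
  {within X, continuous u} -> {within Y, continuous v} ->
  {within X `*` Y, continuous c} ->
  (forall x y, X x -> Y y -> u x + v y <= c (x, y)) ->
  (Fstar X Y F (fun z => (u z.1 + v z.2)%R) <= Fstar X Y F c)%E.

Definition PiP (R : realType) (D : nat) (X Y : set 'rV[R]_D)
    (P : probability (BX R D) R) (pi : probability (BXY R D) R) : Prop :=
  pi (X `*` Y) = 1%E /\
  forall A : set (BX R D), measurable A -> pi (A `*` setT) = P A.

Definition PiPQ (R : realType) (D : nat) (X Y : set 'rV[R]_D)
    (P Q : probability (BX R D) R) (pi : probability (BXY R D) R) : Prop :=
  PiP X Y P pi /\
  forall B : set (BX R D), measurable B -> pi (setT `*` B) = Q B.

Definition chg (R : realType) (D : nat) (pi : probability (BXY R D) R)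
  : {charge set BXY R D -> \bar R} := charge_of_finite_measure pi.

(* L(v, pi) = F(pi) - int_Y v d pi_Y + int_Y v dQ, where                     *)
(* int_Y v d pi_Y is written as int_{X x Y} v(y) d pi(x, y).                  *)
Definition Lag (R : realType) (D : nat) (X Y : set 'rV[R]_D)
    (F : {charge set BXY R D -> \bar R} -> \bar R)
    (Q : probability (BX R D) R)
    (v : 'rV[R]_D -> R) (pi : probability (BXY R D) R) : \bar R :=
  (F (chg pi) - \int[pi]_(z in (X `*` Y : set (BXY R D))) (v z.2)%:E
   + \int[Q]_(y in (Y : set (BX R D))) (v y)%:E)%E.

Definition dual_obj (R : realType) (D : nat) (X Y : set 'rV[R]_D)
    (F : {charge set BXY R D -> \bar R} -> \bar R)
    (P Q : probability (BX R D) R) (v : 'rV[R]_D -> R) : \bar R :=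
  ereal_inf [set Lag X Y F Q v pi | pi in [set pi | PiP X Y P pi]].

(* Main.v *)
Require Import Defs.
From HB Require Import structures.
From mathcomp Require Import all_boot all_order all_algebra.
From mathcomp Require Import all_classical all_reals all_analysis.
From mathcomp Require Import measurable_realfun lra ring.
Import Order.TTheory GRing.Theory Num.Theory numFieldNormedType.Exports.
Local Open Scope classical_set_scope.
Local Open Scope ring_scope.

(** If there is no duality gap, i.e. if the supremum over [v] of
    [inf_(pi in Pi(P)) L v pi] is [Cost(P, Q)], then an optimal potential [v0]
    and an OT plan [pi0] satisfy
    [L v0 pi0 = F pi0 = Cost(P, Q) = inf_(pi in Pi(P)) L v0 pi].

    The absence of a gap is a minimax argument. Suppose that for some
    [a < Cost(P, Q)] every potential [v] has a plan [pi] in [Pi(P)] with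
    [L v pi < a]. As [L] is affine in [v] and convex in [pi], any finite
    number of potentials then has a common such plan. Hence there is an
    ultrafilter on [Pi(P)] along which [L v _ < a] eventually, for each [v].
    It has a weak-* limit because [X x Y] is compact: the setwise limit of the
    measures along the ultrafilter is only finitely additive, but its
    regularization is a Borel probability measure which integrates continuous
    functions to the same limits. Testing against [t v] for all real [t] shows
    that the limit has second marginal [Q], and lower semi-continuity gives it
    a value of [F] at most [a], a contradiction. *)

Set Implicit Arguments.
Unset Strict Implicit.
Unset Printing Implicit Defensive.

(** * A minimax alternative *)

Section alternative.
Context {R : realType} {T : Type}.

(** Points with [g x < 0] bound the weight [t] from below, points with [f x < 0] bound it from
    above. If some lower bound exceeded an upper one, a suitable combination of the two points would
    make both functions negative. No convex structure on [T] is involved: a point doing at least as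
    well as the combination suffices. *)
Lemma convexlike_pair (S : set T) (f g : T -> R) :
  (forall x y t, S x -> S y -> 0 < t < 1 ->
     exists z, [/\ S z, f z <= t * f x + (1 - t) * f y
                      & g z <= t * g x + (1 - t) * g y]) ->
  (forall x, S x -> 0 <= f x \/ 0 <= g x) ->
  exists t, 0 <= t <= 1 /\ forall x, S x -> 0 <= t * f x + (1 - t) * g x.
Proof.
move=> cvx alt.
(* Where [g < 0 <= f], the weight [t] must satisfy [- g / (f - g) <= t]. *)
pose A := [set r |
  r = 0 \/ exists2 x, S x /\ g x < 0 & r = - g x / (f x - g x)].
have A0 : A 0 by left.
have Aub b : 0 <= b -> (forall x, S x -> g x < 0 -> - g x <= b * (f x - g x)) ->
    ubound A b.
  move=> b0 h r [->//|[x [Sx gx] ->]].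
  have fx : 0 <= f x by case: (alt _ Sx) => //; lra.
  by rewrite ler_pdivrMr; [exact: h|lra].
have A1 : ubound A 1.
  by apply: Aub => // x Sx gx; case: (alt _ Sx); lra.
have supA : has_sup A by split; [exists 0|exists 1].
have t0 : 0 <= sup A by apply: ub_le_sup => //; exists 1.
have t1 : sup A <= 1 by apply: ge_sup => //; exists 0.
exists (sup A); split=> [|x Sx]; first by rewrite t0 t1.
have [gx|gx] := ltP (g x) 0.
  have fx : 0 <= f x by case: (alt _ Sx) => //; lra.
  have : - g x / (f x - g x) <= sup A.
    by apply: ub_le_sup; [exists 1|right; exists x].
  by rewrite ler_pdivrMr; [nra|lra].
have [fx|fx] := ltP (f x) 0; last by nra.
have : sup A <= g x / (g x - f x).
  apply: ge_sup; first by exists 0.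
  apply: Aub => [|y Sy gy]; first by rewrite divr_ge0//; lra.
  have fy : 0 <= f y by case: (alt _ Sy) => //; lra.
  rewrite mulrAC ler_pdivlMr; last lra.
  rewrite leNgt; apply/negP => lt.
  (* The combination of [x] and [y] at which both bounds become negative. *)
  pose w := (f y - g y) + (g x - f x).
  have w0 : 0 < w by rewrite /w; lra.
  have [z [Sz]] : exists z, [/\ S z,
      f z <= (f y - g y) / w * f x + (1 - (f y - g y) / w) * f y
    & g z <= (f y - g y) / w * g x + (1 - (f y - g y) / w) * g y].
    apply: cvx => //; rewrite divr_gt0//=; last lra.
    by rewrite ltr_pdivrMr//; rewrite /w; lra.
  have -> : 1 - (f y - g y) / w = (g x - f x) / w by rewrite /w; field; lra.
  rewrite ![_ / w * _]mulrAC -!mulrDl !ler_pdivlMr//.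
  by case: (alt _ Sz); nra.
by rewrite ler_pdivlMr; [nra|lra].
Qed.

(** Induction on [l]: the sublevel set of the head [v] inherits convexity from [S], so the tail
    yields a [w] with [a <= phi w] on that set. Then [v] and [w] satisfy the alternative of
    [convexlike_pair], and the resulting mixture is again of the form [phi u]. *)
Lemma convexlike_alt (V : eqType) (W : set V) (phi : V -> T -> R) (a : R)
    (S : set T) (l : seq V) :
  W !=set0 -> {subset l <= W} ->
  (forall v w t, W v -> W w -> 0 <= t <= 1 ->
     exists2 u, W u & forall x, phi u x = t * phi v x + (1 - t) * phi w x) ->
  (forall x y t, S x -> S y -> 0 < t < 1 ->
     exists2 z, S z &
       forall v, W v -> phi v z <= t * phi v x + (1 - t) * phi v y) ->
  ~ (exists2 x, S x & {in l, forall v, phi v x < a}) ->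
  exists2 v, W v & forall x, S x -> a <= phi v x.
Proof.
move=> W0 + cve; elim: l S => [|v l IH] S lW cvx nS.
  (* Without constraints, [nS] says that [S] is empty. *)
  by have [v Wv] := W0; exists v => // x Sx; case: nS; exists x.
have Wv : W v by have /[!inE] := lW v (mem_head _ _).
have [w Ww hw] : exists2 w, W w & forall x, (S `&` [set x | phi v x < a]) x ->
    a <= phi w x.
  apply: IH => [u ul|x y t [Sx /= vx] [Sy /= vy] t01|[x [Sx /= vx] lx]].
  - by apply: lW; rewrite inE ul orbT.
  - have [z Sz hz] := cvx _ _ _ Sx Sy t01; exists z => //; split=> //=.
    by apply: le_lt_trans (hz _ Wv) _; nra.
  - apply: nS; exists x => // u; rewrite inE => /predU1P[->//|]; exact: lx.
have [x y t Sx Sy t01|x Sx|t [t01 ht]] :=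
  @convexlike_pair S (fun x => phi v x - a) (fun x => phi w x - a).
- have [z Sz hz] := cvx _ _ _ Sx Sy t01; exists z.
  by have := hz _ Wv; have := hz _ Ww; split => //; lra.
- have [vx|vx] := ltP (phi v x) a; [right|left]; last by rewrite subr_ge0.
  by rewrite subr_ge0 hw.
- have [u Wu hu] := cve _ _ _ Wv Ww t01; exists u => // x Sx.
  by rewrite hu; have := ht _ Sx; lra.
Qed.

End alternative.

(** * Regularization of a finitely additive measure *)

Lemma measure_probability d (T : measurableType d) (R : realType)
    (mu : {measure set T -> \bar R}) : mu setT = 1%E ->
  exists P : probability T R, (P : set T -> \bar R) = mu.
Proof.
move=> mu1; pose f := mu : set T -> \bar R.
pose fM := isMeasure.Build _ T R f (measure0 mu) (measure_ge0 mu)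
  (@measure_semi_sigma_additive _ _ _ mu).
pose nu : {measure set T -> \bar R} := HB.pack f fM.
pose P : probability T R :=
  HB.pack f fM (@Measure_isProbability.Build _ T R nu mu1).
by exists P.
Qed.

(** * Borel sets and compact sets of a normed space *)

Section borel.
Context {R : realType} {T : normedModType R}.
Local Notation B := (g_sigma_algebraType (@open T)).

Lemma open_borel (A : set B) : open (A : set T) -> measurable A.
Proof. by move=> oA; exact: sub_gen_smallest. Qed.

Lemma closed_borel (A : set B) : closed (A : set T) -> measurable A.
Proof.
move=> cA; rewrite -(setCK A); apply: measurableC; apply: open_borel.
exact: closed_openC.
Qed.

Lemma compact_borel (A : set B) : compact (A : set T) -> measurable A.
Proof.
by move=> cA; apply: closed_borel; exact: compact_closed.
Qed.

(** By normality, the disjoint closed sets [C] minus [U] and [C] minus [V] have disjoint open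
    neighbourhoods; removing one or the other from [C] gives the two pieces. *)
Lemma compact_split (C U V : set T) : compact C -> open U -> open V ->
  C `<=` U `|` V ->
  exists C1 C2,
    [/\ compact C1, compact C2, C1 `<=` U, C2 `<=` V & C = C1 `|` C2].
Proof.
move=> cC oU oV CUV; have clC := compact_closed (@norm_hausdorff _ _) cC.
have [| | |U' [V' [oU' oV' CU' CV' UV0]]] :=
  (@normal_openP R T).1 pseudometric_normal (C `&` ~` U) (C `&` ~` V).
- by apply: closedI => //; exact: open_closedC.
- by apply: closedI => //; exact: open_closedC.
- by rewrite setIACA setIid -setCU; apply/disjoints_subset; rewrite setCK.
exists (C `&` ~` U'), (C `&` ~` V'); split.
- by apply: compact_closedI => //; exact: open_closedC.
- by apply: compact_closedI => //; exact: open_closedC.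
- by move=> x [Cx nx]; apply: contrapT => Ux; apply: nx; apply: CU'.
- by move=> x [Cx nx]; apply: contrapT => Vx; apply: nx; apply: CV'.
- by rewrite -setIUr -setCI UV0 setC0 setIT.
Qed.

End borel.

Section inner_content.
Context {R : realType} {T : normedModType R}.
Local Notation B := (g_sigma_algebraType (@open T)).
Variable m : set B -> R.

(** Approximation of open sets from inside by compact sets, followed by approximation of all sets
    from outside by open sets, turns the finitely additive [m] into an outer measure: compactness
    reduces countable covers to finite ones. *)
Definition inner_content (G : set T) : R :=
  sup [set m C | C in [set C | compact C /\ C `<=` G]].

Definition outer_content (E : set T) : R :=
  inf [set inner_content G | G in [set G | open G /\ E `<=` G]].

Hypotheses (m_ge0 : forall A, measurable A -> 0 <= m A)
  (mU : forall A A', measurable A -> measurable A' -> A `&` A' = set0 ->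
     m (A `|` A') = m A + m A').

Lemma content_le A A' : measurable A -> measurable A' -> A `<=` A' ->
  m A <= m A'.
Proof.
move=> mA mA' AA'.
rewrite -(setDUK AA') mU// ?setDIK//; last exact: measurableD.
by rewrite lerDl m_ge0//; exact: measurableD.
Qed.

Lemma content0 : m set0 = 0.
Proof.
by have := mU measurable0 measurable0 (setI0 _); rewrite setU0; lra.
Qed.

Let has_sup_inner G : has_sup [set m C | C in [set C | compact C /\ C `<=` G]].
Proof.
split.
  by exists (m set0), set0 => //; split; [exact: compact0|exact: sub0set].
exists (m setT) => _ [C [cC _] <-]; apply: content_le => //.
exact: compact_borel.
Qed.

Lemma inner_content_ub C G : compact C -> C `<=` G -> m C <= inner_content G.
Proof.
by move=> cC CG; apply: ub_le_sup; [case: (has_sup_inner G)|exists C].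
Qed.

Lemma inner_content_le G r :
  (forall C, compact C -> C `<=` G -> m C <= r) -> inner_content G <= r.
Proof.
move=> h; apply: ge_sup; first by case: (has_sup_inner G).
by move=> _ [C [cC CG] <-]; exact: h.
Qed.

Lemma inner_content_ge0 G : 0 <= inner_content G.
Proof. by rewrite -content0 inner_content_ub//; exact: compact0. Qed.

Lemma inner_content_le_open G : open G -> inner_content G <= m G.
Proof.
move=> oG; apply: inner_content_le => C cC CG.
by apply: content_le => //; [exact: compact_borel|exact: open_borel].
Qed.

Let has_inf_outer E :
  has_inf [set inner_content G | G in [set G | open G /\ E `<=` G]].
Proof.
split; first by exists (inner_content setT), setT => //; split; [exact: openT|].
by exists 0 => _ [G _ <-]; exact: inner_content_ge0.
Qed.

Lemma outer_content_lb E G : open G -> E `<=` G ->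
  outer_content E <= inner_content G.
Proof.
by move=> oG EG; apply: ge_inf; [case: (has_inf_outer E)|exists G].
Qed.

Lemma outer_content_ge E r :
  (forall G, open G -> E `<=` G -> r <= inner_content G) ->
  r <= outer_content E.
Proof.
move=> h; apply: lb_le_inf; first by case: (has_inf_outer E).
by move=> _ [G [oG EG] <-]; exact: h.
Qed.

Lemma outer_content_open G : open G -> outer_content G = inner_content G.
Proof.
move=> oG; apply/eqP; rewrite eq_le outer_content_lb//=.
apply: outer_content_ge => G' oG' GG'; apply: inner_content_le => C cC CG.
by apply: inner_content_ub => //; exact: subset_trans GG'.
Qed.

Lemma outer_content_ge0 E : 0 <= outer_content E.
Proof. by apply: outer_content_ge => G _ _; exact: inner_content_ge0. Qed.

Lemma outer_content0 : outer_content set0 = 0.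
Proof.
apply/eqP; rewrite eq_le outer_content_ge0 andbT -content0.
rewrite outer_content_open; last exact: open0.
by apply: inner_content_le => C _; rewrite subset0 => ->.
Qed.

Lemma le_outer_content E E' : E `<=` E' -> outer_content E <= outer_content E'.
Proof.
move=> EE'; apply: outer_content_ge => G oG E'G.
by apply: outer_content_lb => //; exact: subset_trans E'G.
Qed.

Lemma content_le_sum_inner (F : nat -> set T) n C : (forall i, open (F i)) ->
  compact C -> C `<=` \big[setU/set0]_(i < n) F i ->
  m C <= \sum_(i < n) inner_content (F i).
Proof.
move=> oF; elim: n C => [|n IH] C cC.
  by rewrite !big_ord0 subset0 => ->; rewrite content0.
rewrite !big_ord_recr/= => /compact_split[//| | //|C1 [C2 [c1 c2 C1F C2F ->]]].
  by rewrite -(bigcup_mkord n F); exact: bigcup_open.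
have mC1 := compact_borel c1; have mC2 := compact_borel c2.
(* Additivity needs disjoint pieces. The difference need not be compact, so it is enlarged back to
   [C2] by monotonicity. *)
have -> : C1 `|` C2 = C1 `|` (C2 `\` C1) by rewrite setDE setUIr setUv setIT.
rewrite mU//; [|exact: measurableD|exact: setDIK].
apply: lerD; first exact: IH.
rewrite (le_trans (content_le _ mC2 _))//; first exact: measurableD.
exact: inner_content_ub.
Qed.

Local Open Scope ereal_scope.

(** Each set gets an open superset with excess [e / 2 ^ n.+1]. A compact subset of the union of
    these is covered by finitely many of them, where [content_le_sum_inner] applies. *)
Lemma outer_content_sigma_subadditive :
  sigma_subadditive (fun E => (outer_content E)%:E).
Proof.
move=> F; apply/lee_addgt0Pr => e e0.
have Ge n : exists G, [/\ open G, F n `<=` G &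
    (inner_content G <= outer_content (F n) + e / (2 ^ n.+1)%:R)%R].
  have en : (0 < e / (2 ^ n.+1)%:R)%R by rewrite divr_gt0// ltr0n expn_gt0.
  have [_ [G [oG FG] <-] lt] := inf_adherent en (has_inf_outer (F n)).
  by exists G; split=> //; exact/ltW.
have [G /all_and3[oG FG Gle]] := choice Ge.
apply: (@le_trans _ _ (\sum_(i <oo) (inner_content (G i))%:E)); last first.
  apply: le_trans (epsilon_trick _ _ (ltW e0)); last first.
    by move=> n; rewrite lee_fin outer_content_ge0.
  by apply: lee_nneseries => n _; rewrite ?lee_fin ?inner_content_ge0//.
have oGG : open (\bigcup_n G n) by exact: bigcup_open.
apply: (@le_trans _ _ (inner_content (\bigcup_n G n))%:E).
  by rewrite lee_fin outer_content_lb//; exact: subset_bigcup.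
set s := (X in _ <= X).
have sC C : compact C -> C `<=` \bigcup_n G n -> (m C)%:E <= s.
  move=> cC CG; have : cover_compact C by rewrite -compact_cover.
  case/(_ _ setT G (fun i _ => oG i) CG) => D _ CD.
  pose N := (\max_(i <- finmap.enum_fset D) i.+1)%N.
  have CN : C `<=` \big[setU/set0]_(i < N) G i.
    move=> x /CD[i /= iD Gi]; rewrite -bigcup_mkord; exists i => //=.
    by rewrite /N (big_rem i)//= leq_max ltnSn.
  apply: le_trans (nneseries_lim_ge N _); last first.
    by move=> k _ _; rewrite lee_fin inner_content_ge0.
  by rewrite big_mkord sumEFin lee_fin content_le_sum_inner.
have {sC} : forall C, compact C -> C `<=` \bigcup_n G n -> (m C)%:E <= s by [].
(* The sum is an extended real; the value [-oo] is ruled out by the empty compact set. *)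
case: s => [r||] h.
- by rewrite lee_fin; apply: inner_content_le => C cC CG; rewrite -lee_fin h.
- exact: leey.
- by have := h set0 compact0 (@sub0set _ _); rewrite leeNy_eq.
Qed.

Hypothesis mT : m setT = 1%R.

Let outerE : set T -> \bar R := fun E => (outer_content E)%:E.

Let mu : {outer_measure set T -> \bar R} := HB.pack outerE
  (isOuterMeasure.Build R T outerE
    (congr1 EFin outer_content0) (fun E => outer_content_ge0 E)
    (fun A A' AA' => le_outer_content AA') outer_content_sigma_subadditive).

Let muE E : mu E = (outer_content E)%:E. Proof. by []. Qed.

(** For an open [G] containing [X], choose a compact [C] in the part of [G] inside [U], then a
    compact [C'] in [G] minus [C]. They are disjoint with union in [G], so their contents add up to
    at most the inner content of [G]. *)
Let open_caratheodory (U : set T) : open U -> mu.-caratheodory U.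
Proof.
move=> oU; apply: le_caratheodory_measurable => X.
rewrite !muE -EFinD lee_fin; apply: outer_content_ge => G oG XG.
have oGU : open (G `&` U) by exact: openI.
apply: (@le_trans _ _ (inner_content (G `&` U) + outer_content (X `&` ~` U))%R).
  by rewrite lerD2r outer_content_lb//; exact: setSI.
rewrite -lerBrDr; apply: inner_content_le => C cC; rewrite subsetI => -[CG CU].
have clC : closed C by exact: compact_closed.
rewrite lerBrDr -lerBrDl.
apply: (@le_trans _ _ (inner_content (G `\` C))).
  apply: outer_content_lb; first by apply: openI => //; exact: closed_openC.
  by move=> x [Xx Ux]; split; [exact: XG|move=> /CU].
apply: inner_content_le => C' cC' C'GC.
rewrite lerBrDl -mU; [|exact: compact_borel|exact: compact_borel|]; last first.
  by apply/disjoints_subset => x Cx /C'GC[].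
apply: inner_content_ub; first exact: compactU.
by rewrite subUset; split => // x /C'GC[].
Qed.

Let borel_caratheodory (A : set B) : measurable A -> mu.-cara.-measurable A.
Proof.
move=> mA; apply: (smallest_sub _ _ mA) => [|U]; last exact: open_caratheodory.
exact: sigma_algebra_measurable.
Qed.

(** [P] is the Caratheodory measure restricted to Borel sets. The compact [K] prevents a loss of
    mass: it already gives inner content 1 to the whole space, and its open complement has content
    0. *)
Lemma content_regularization (K : set T) : compact K -> m K = 1%R ->
  exists P : probability B R,
    [/\ P K = 1 & forall G : set T, open G -> P G <= (m G)%:E].
Proof.
move=> cK mK.
pose nu : set B -> \bar R := outerE.
have nuS : semi_sigma_additive nu.
  move=> F mF tF mUF.
  apply: (@caratheodory_measure_sigma_additive R T mu) => //.
    by move=> i; exact: borel_caratheodory.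
  exact: borel_caratheodory.
have outerT : outer_content setT = 1%R.
  rewrite outer_content_open; last exact: openT.
  apply/eqP; rewrite eq_le -[X in (_ <= X)%R]mT inner_content_le_open.
    by rewrite -mK inner_content_ub.
  exact: openT.
pose nuM : {measure set B -> \bar R} := HB.pack nu (isMeasure.Build _ B R nu
  (congr1 EFin outer_content0) (fun E => outer_content_ge0 E) nuS).
have [P PE] := measure_probability (congr1 EFin outerT : nuM setT = 1).
have PG G : open G -> P G <= (m G)%:E.
  by move=> oG; rewrite PE lee_fin outer_content_open// inner_content_le_open.
exists P; split => //.
have mKB := compact_borel cK.
have oKC : open (~` K).
  by apply: closed_openC; apply: compact_closed => //; exact: norm_hausdorff.
have mKC : m (~` K) = 0%R.
  have := mU mKB (measurableC mKB) (setICr K).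
  by rewrite setUCr mT mK; lra.
have PKC : P (~` K) = 0.
  by apply/eqP; rewrite eq_le measure_ge0 andbT (le_trans (PG _ oKC))// mKC.
by rewrite -(setCK K) probability_setC ?PKC ?sube0//; exact: measurableC.
Qed.

End inner_content.

(** * Weak-* limits along an ultrafilter *)

Section ultrafilter_limit.
Context {R : realType}.

(** The compact segment provides a cluster point, and an ultrafilter converges to its cluster
    points. *)
Lemma ultra_cvg (I : Type) (U : set_system I) (f : I -> R) a b :
  UltraFilter U -> (forall i, f i \in `[a, b]) -> cvg (f @ U).
Proof.
move=> UU fab; have [l [_ cl]] : [set` `[a, b]] `&` cluster (f @ U) !=set0.
  apply: segment_compact; apply: (@filterE _ U) => i; exact: fab.
apply/cvg_ex; exists l => A lA.
have [//|UA] := in_ultra_setVsetC (f @^-1` A) UU.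
have : (f @ U) (~` A) by [].
by move=> /cl /(_ lA) [x []].
Qed.

Context {T : normedModType R}.
Local Notation B := (g_sigma_algebraType (@open T)).

(** On an open set the regularization lies below the setwise limit [m]. This is the portmanteau
    inequality, which suffices for the convergence of integrals of continuous functions. *)
Lemma ultra_portmanteau (U : set_system (probability B R)) (K : set T) :
  UltraFilter U -> compact K -> U [set p : probability B R | p K = 1%E] ->
  exists P : probability B R, P K = 1%E /\
    forall (G : set T) (e : R), open G -> 0 < e ->
      U [set p : probability B R | fine (P G) <= fine (p G) + e].
Proof.
move=> UU cK UK; have mK := compact_borel cK.
(* The default 0 off the Borel sets makes the limit exist for every [A]. *)
pose f (A : set B) (p : probability B R) :=
  if `[<measurable A>] then fine (p A) else 0.
have fE A p : measurable A -> f A p = fine (p A).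
  by move=> mA; rewrite /f asboolT.
have cf A : cvg (f A @ U).
  apply: (@ultra_cvg _ _ _ 0 1) => p; rewrite /f; case: ifPn => [/asboolP mA|_].
    rewrite in_itv/= fine_ge0//= -lee_fin fineK ?fin_num_measure//.
    exact: probability_le1.
  by rewrite in_itv /= lexx ler01.
pose m A := lim (f A @ U).
have m_ge0 A : measurable A -> 0 <= m A.
  move=> mA; apply: limr_ge => //; near=> p; first by rewrite fE// fine_ge0.
have mU A A' : measurable A -> measurable A' -> A `&` A' = set0 ->
    m (A `|` A') = m A + m A'.
  move=> mA mA' AA'; rewrite -limD//; congr (lim (_ @ U)); apply/funext => p /=.
  have mAA := measurableU _ _ mA mA'.
  by rewrite !fctE !fE// measureU// fineD ?fin_num_measure.
have mT : m setT = 1.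
  apply: (@lim_near_cst R) => //.
  by apply: filterE => p; rewrite fE//= probability_setT.
have mK1 : m K = 1.
  apply: lim_near_cst => //.
  by apply: filterS UK => p pK; rewrite fE//= pK.
have [P [PK PG]] := content_regularization m_ge0 mU mT cK mK1.
exists P; split=> // G e oG e0.
have mG := open_borel oG.
have : U [set p | m G - e < f G p].
  by apply: (cvgr_gt (m G) (cf G)); rewrite ltrBlDr ltrDl.
apply: filterS => p /=; rewrite fE// ltrBlDr => /ltW; apply: le_trans.
by rewrite -lee_fin fineK ?fin_num_measure//; exact: PG.
Unshelve. all: by end_near. Qed.

End ultrafilter_limit.

(** * Convergence of integrals of continuous functions *)

Lemma sumr_ltn_bounds (R : realType) (n : nat) (x : R) : 0 <= x <= n%:R ->
  x <= \sum_(k < n) ((k%:R < x)%R)%:R <= x + 1.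
Proof.
case/andP=> x0 xn.
pose S m : R := \sum_(k < m) ((k%:R < x)%R)%:R.
(* Generalized for the induction: [S n] equals [n] while [n <= x], and stops growing once
   [x <= n]. *)
suff : [/\ S n <= n%:R, S n <= x + 1, x <= n%:R -> x <= S n &
    n%:R <= x -> n%:R <= S n].
  by move=> [_ h1 h2 _]; rewrite h1 h2.
elim: n {xn} => [|n [h1 h2 h3 h4]].
  by rewrite /S big_ord0; split => //; lra.
have -> : S n.+1 = S n + ((n%:R < x)%R)%:R by rewrite /S big_ord_recr.
rewrite -natr1; case: ltP => [nx|xn] /=.
  by have := h4 (ltW nx); split; lra.
by have := h3 xn; split; lra.
Qed.

Section continuous_integral.
Context {R : realType} {T : normedModType R}.
Local Notation B := (g_sigma_algebraType (@open T)).

Lemma within_continuous_measurable (K : set B) (h : T -> R) : measurable K ->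
  {within (K : set T), continuous h} -> measurable_fun K (h : B -> R).
Proof.
move=> mK /continuousP ch; apply: (measurability _ (RGenOpens.measurableE R)).
move=> _ [_ [a [b ->] <-]].
have oab : open `]a, b[%classic by exact: interval_open.
have /open_subspaceP[V oV VK] := ch _ oab.
by rewrite setIC -VK; apply: measurableI => //; exact: open_borel.
Qed.

Lemma within_continuous_integrable (P : probability B R) (K : set T)
    (h : T -> R) : compact K -> {within K, continuous h} ->
  P.-integrable (K : set B) (EFin \o h).
Proof.
move=> cK ch; have mK := compact_borel cK.
apply: measurable_bounded_integrable => //.
- by rewrite (le_lt_trans (probability_le1 _ mK))// ltry.
- exact: within_continuous_measurable.
- have /compact_bounded[M [_ mrt]] := continuous_compact ch cK.
  by exists M; split; rewrite ?num_real // => ? ? ? ?; exact: mrt.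
Qed.

(* Integrates the pointwise bound
   [n h <= #|{k < n | k < n h}| <= n h + 1] for [0 <= h <= 1]. *)
Lemma layer_cake (P : probability B R) (K : set B) (h : B -> R) (n : nat) :
  measurable K -> measurable_fun K h -> (forall z, K z -> 0 <= h z <= 1) ->
  n%:R * \int[P]_(z in K) h z
    <= \sum_(k < n) fine (P (K `&` [set z | k%:R < n%:R * h z]))
    <= n%:R * \int[P]_(z in K) h z + 1.
Proof.
move=> mK mh h01; pose E k := K `&` [set z | k%:R < n%:R * h z].
have mnh : measurable_fun K (fun z => n%:R * h z) by exact: measurable_funM.
have mE k : measurable (E k).
  have -> : E k = K `&` (fun z => n%:R * h z) @^-1` `]k%:R, +oo[.
    by rewrite preimage_itvoy.
  exact: mnh.
have PK : (P K < +oo)%E by rewrite (le_lt_trans (probability_le1 _ mK))// ltry.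
have inth : P.-integrable K (EFin \o h).
  apply: measurable_bounded_integrable => //.
  exists 1; split => // M M1 z /= Kz; have /andP[h0 h1] := h01 z Kz.
  by rewrite ger0_norm// (le_trans h1)// ltW.
have intE k : P.-integrable K (EFin \o \1_(E k)).
  by apply: (integrableS measurableT) => //; exact: integrable_indic.
have -> : \sum_(k < n) fine (P (E k)) =
    \int[P]_(z in K) (\sum_(k < n) \1_(E k) z).
  rewrite /Rintegral; under eq_integral do rewrite -sumEFin.
  rewrite integral_sum//=; last by move=> k; exact: intE.
  transitivity (\sum_(k < n) fine (\int[P]_(z in K) (\1_(E k) z)%:E));
      last first.
    by apply: sum_fine => k _; apply: integrable_fin_num => //; exact: intE.
  apply: eq_bigr => k _; rewrite integral_indic//.
  by congr (fine (P _)); rewrite /E setIAC setIid.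
have intS : P.-integrable K (EFin \o (fun z => \sum_(k < n) \1_(E k) z)).
  apply: (eq_integrable mK (fun z => \sum_(k < n) (\1_(E k) z)%:E)%E).
    by move=> z _; rewrite /= sumEFin.
  by apply: integrable_sum => //= k _; exact: intE.
have intnh : P.-integrable K (EFin \o (fun z => n%:R * h z)).
  by have := integrableZl mK n%:R inth.
have int1 : P.-integrable K (EFin \o cst 1).
  exact: finite_measure_integrable_cst.
have bnd z : K z -> n%:R * h z <= \sum_(k < n) \1_(E k) z <= n%:R * h z + 1.
  move=> Kz; have /andP[h0 h1] := h01 z Kz.
  have -> : \sum_(k < n) \1_(E k) z =
      \sum_(k < n) ((k%:R < n%:R * h z)%R)%:R :> R.
    apply: eq_bigr => k _; rewrite indicE; congr ((nat_of_bool _)%:R).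
    by apply/idP/idP; rewrite inE /E /=; tauto.
  by apply: sumr_ltn_bounds; rewrite mulr_ge0//= ler_piMr.
rewrite -RintegralZl//; apply/andP; split.
  by apply: le_Rintegral => // z /bnd/andP[].
apply: (@le_trans _ _ (\int[P]_(z in K) (n%:R * h z + 1))).
  apply: le_Rintegral => //; last by move=> z /bnd/andP[].
  by have := integrableD mK intnh int1.
rewrite RintegralD// lerD2l Rintegral_cst// mul1r -lee_fin fineK.
  exact: probability_le1.
by rewrite ge0_fin_numE.
Qed.

Lemma within_continuous_upper (K : set T) (h : T -> R) (a : R) :
  {within K, continuous h} ->
  exists2 V : set T, open V & K `&` [set z | a < h z] = K `&` V.
Proof.
move=> /continuousP ch.
have oa : open `]a, +oo[%classic by exact: interval_open.
have /open_subspaceP[V oV VK] := ch _ oa; exists V => //.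
by rewrite [RHS]setIC VK setIC preimage_itvoy.
Qed.

Section limit.
Variables (U : set_system (probability B R)) (K : set T) (P : probability B R).
Hypotheses (UU : ProperFilter U) (cK : compact K) (PK : P K = 1%E).
Hypothesis UK : U [set p : probability B R | p K = 1%E].
Hypothesis PG : forall (G : set T) (e : R), open G -> 0 < e ->
  U [set p : probability B R | fine (P G) <= fine (p G) + e].

Let setI_full (p : probability B R) (A : set B) : p K = 1%E -> measurable A ->
  p (K `&` A) = p A.
Proof.
move=> pK mA; have mK := compact_borel cK.
have pKC : p (~` K) = 0%E by rewrite probability_setC// pK subee.
apply/eqP; rewrite eq_le le_measure ?inE//=; last exact: measurableI.
rewrite -[leRHS]adde0 -pKC (le_trans _ (measureU2 _ _ _))//.
- apply: le_measure; rewrite ?inE//.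
    by apply: measurableU; [exact: measurableI|exact: measurableC].
  by move=> x Ax; have [Kx|Kx] := pselect (K x); [left|right].
- exact: measurableI.
- exact: measurableC.
Qed.

(** By [layer_cake] the integral is, up to [1 / n], the mean of the measures of [n] superlevel sets.
    Each of these is the trace on [K] of an open set, to which [PG] applies since [K] has full
    measure. *)
Let limit01 (h : T -> R) (e : R) : {within K, continuous h} ->
  (forall z, K z -> 0 <= h z <= 1) -> 0 < e ->
  U [set p : probability B R |
     \int[P]_(z in K) h z <= \int[p]_(z in K) h z + e].
Proof.
move=> ch h01 e0; have mK := compact_borel cK.
have mh := within_continuous_measurable mK ch.
(* One half of [e] absorbs the discretization error [1 / n], the other half the error on each
   layer. *)
have [n ne] : exists n : nat, 2 / e < n%:R.
  by exists (Num.truncn (2 / e)).+1; rewrite truncnS_gt.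
have n0 : 0 < n%:R :> R by rewrite (lt_trans _ ne)// divr_gt0.
have hk (k : 'I_n) : U [set p : probability B R |
    fine (P (K `&` [set z | k%:R < n%:R * h z])) <=
    fine (p (K `&` [set z | k%:R < n%:R * h z])) + e / 2].
  have -> : [set z | k%:R < n%:R * h z] = [set z | k%:R / n%:R < h z].
    by apply/seteqP; split => z /=; rewrite ltr_pdivrMr// mulrC.
  have [V oV ->] := within_continuous_upper (k%:R / n%:R) ch.
  have mV := open_borel oV.
  have e20 : 0 < e / 2 by rewrite divr_gt0.
  by apply: filterS2 UK (PG oV e20) => p pK; rewrite /= !setI_full.
apply: filterS2 UK (filter_forall _ hk) => p pK /= hp.
have /andP[h1 _] := layer_cake P n mK mh h01.
have /andP[_ h2] := layer_cake p n mK mh h01.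
have h3 : \sum_(k < n) fine (P (K `&` [set z | k%:R < n%:R * h z])) <=
    \sum_(k < n) fine (p (K `&` [set z | k%:R < n%:R * h z])) + n%:R * (e / 2).
  have -> : n%:R * (e / 2) = \sum_(k < n) e / 2.
    by rewrite sumr_const card_ord mulr_natl.
  rewrite -big_split/=.
  by apply: ler_sum => k _; exact: hp.
rewrite -(ler_pM2l n0) mulrDr.
have : 2 < n%:R * e by rewrite -ltr_pdivrMr.
by move: h1 h2 h3; lra.
Qed.

(** The one-sided [limit01] is applied to both [a * h + 1/2] and [- a * h + 1/2], where [a] scales
    [h] so that these take values in the unit interval on [K]. *)
Lemma Rintegral_limit (h : T -> R) (e : R) :
  {within K, continuous h} -> 0 < e ->
  U [set p : probability B R |
     `|\int[p]_(z in K) h z - \int[P]_(z in K) h z| < e].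
Proof.
move=> ch e0; have mK := compact_borel cK.
have [M M0 hM] : exists2 M : R, 0 < M & forall z, K z -> `|h z| <= M.
  have /compact_bounded[M [_ mrt]] := continuous_compact ch cK.
  exists (`|M| + 1); first by rewrite ltr_wpDl.
  by move=> z Kz; apply: mrt; [rewrite ltr_pwDr// ler_norm|exists z].
pose a := (2 * M)^-1; have a0 : 0 < a by rewrite invr_gt0 mulr_gt0.
have aff (c : R) (p : probability B R) : p K = 1%E ->
    \int[p]_(z in K) (c * h z + 2^-1) = c * \int[p]_(z in K) h z + 2^-1.
  move=> pK; have ih := within_continuous_integrable p cK ch.
  rewrite RintegralD//; last exact: finite_measure_integrable_cst.
  - rewrite RintegralZl// Rintegral_cst// -[in RHS](mulr1 2^-1).
    by congr (_ + _ * _); rewrite [LHS](congr1 fine pK).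
  - by have := integrableZl mK c ih.
have one (c : R) : `|c| = a -> U [set p : probability B R |
    c * \int[P]_(z in K) h z <= c * \int[p]_(z in K) h z + a * (e / 2)].
  move=> ca.
  have ch' : {within K, continuous (fun z => c * h z + 2^-1)}.
    by move=> z; apply: cvgD; [apply: cvgMr; exact: ch|exact: cvg_cst].
  have h01 z : K z -> 0 <= c * h z + 2^-1 <= 1.
    move=> /hM hz; have : `|c * h z| <= 2^-1.
      rewrite normrM ca /a invfM -mulrA ler_piMr ?invr_ge0//.
      by rewrite ler_pdivrMl// mulr1.
    by rewrite ler_norml; lra.
  have ae0 : 0 < a * (e / 2) by rewrite mulr_gt0// divr_gt0.
  apply: filterS2 UK (limit01 ch' h01 ae0) => p pK /=.
  by rewrite !aff//; lra.
have aa : `|a| = a by rewrite gtr0_norm.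
have naa : `|- a| = a by rewrite normrN.
apply: filterS2 (one _ aa) (one _ naa) => p /= h1 h2.
rewrite -(ltr_pM2l a0) -{1}aa -normrM ltr_norml.
have : 0 < a * (e / 2) by rewrite mulr_gt0// divr_gt0.
have -> : a * e = a * (e / 2) + a * (e / 2) by rewrite -mulrDr -splitr.
by move: h1 h2; lra.
Qed.

End limit.
End continuous_integral.

(** * Uniqueness of Borel probability measures *)

Lemma open_bigcup_closed (R : realType) (T : normedModType R) (G : set T) :
  open G -> exists C : (set T)^nat,
    [/\ forall n, closed (C n), nondecreasing_seq C & \bigcup_n C n = G].
Proof.
move=> oG; pose C n := ~` \bigcup_(y in ~` G) ball y (n.+1%:R^-1 : R).
exists C; split.
- by move=> n; apply: open_closedC; apply: bigcup_open => y _; exact: ball_open.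
- move=> m n mn; rewrite subsetEset; apply: subsetC => x [y Gy yx].
  exists y => //.
  by apply: le_ball yx; rewrite lef_pV2 ?posrE// ler_nat.
- apply/seteqP; split=> [x [n _ Cx]|x Gx].
    by apply: contrapT => Gx; apply: Cx; exists x => //; apply: ballxx.
  have /nbhs_ballP[e /= e0 xeG] := open_nbhs_nbhs (conj oG Gx).
  have [n ne] : exists n : nat, e^-1 < n.+1%:R.
    by exists (Num.truncn e^-1); rewrite truncnS_gt.
  exists n => // -[y Gy /ball_sym xy]; apply: Gy; apply: xeG; apply: le_ball xy.
  by rewrite -[leRHS]invrK lef_pV2 ?posrE ?invr_gt0//; exact: ltW.
Qed.

Section borel_probability.
Context {R : realType} {T : normedModType R}.
Local Notation B := (g_sigma_algebraType (@open T)).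

(** A one-sided bound is enough. Exhausting open sets by closed ones gives [p <= q] on open sets;
    complements give [q <= p] on closed sets; a second exhaustion gives [q <= p] on open sets, which
    form a generating pi-system. *)
Lemma probability_closed_open_unique (p q : probability B R) :
  (forall C G : set T, closed C -> open G -> C `<=` G -> (p C <= q G)%E) ->
  forall A, measurable A -> p A = q A.
Proof.
move=> pq.
have approx (r s : probability B R) (G : set T) : open G ->
    (forall C : set T, closed C -> C `<=` G -> (r C <= s G)%E) ->
    (r G <= s G)%E.
  move=> oG rs; have [C [cC ndC CG]] := open_bigcup_closed oG.
  have : r \o C @ \oo --> r (\bigcup_n C n).
    apply: nondecreasing_cvg_mu => //; first by move=> n; exact: closed_borel.
    by rewrite CG; exact: open_borel.
  rewrite CG => cvgr; rewrite -(cvg_lim _ cvgr)//.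
  apply: lime_le; first exact: cvgP cvgr.
  by apply: nearW => n /=; apply: rs => //; rewrite -CG; exact: bigcup_sup.
have le_pq G : open G -> (p G <= q G)%E.
  by move=> oG; apply: approx => // C cC; exact: pq.
have le_qp G : open G -> (q G <= p G)%E.
  move=> oG; apply: approx => // C cC CG.
  have mC := closed_borel cC; have mG := open_borel oG.
  apply: (@le_trans _ _ (p C)); last by apply: le_measure; rewrite ?inE.
  have := le_pq _ (closed_openC cC); rewrite !probability_setC//.
  rewrite -(fineK (fin_num_measure p _ mC)) -(fineK (fin_num_measure q _ mC)).
  by rewrite -!EFinB !lee_fin; lra.
have uniq := @g_sigma_algebra_measure_unique _ R B (@open T).
move=> A mA; apply: (uniq _ (fun=> setT) _ _ p q) => //.
- by move=> U; exact: open_borel.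
- by move=> _; exact: openT.
- by rewrite bigcup_const.
- by move=> U V; exact: openI.
- by move=> U oU; apply/eqP; rewrite eq_le le_pq// le_qp.
- by move=> _; rewrite -ge0_fin_numE// fin_num_measure.
Qed.

Lemma continuous01_integrable (p : probability B R) (f : T -> R) :
  continuous f -> range f `<=` `[0, 1]%classic ->
  p.-integrable [set: B] (EFin \o (f : B -> R)).
Proof.
move=> cf f01; apply: measurable_bounded_integrable => //.
- by rewrite -ge0_fin_numE// fin_num_measure.
- by apply: within_continuous_measurable => //; exact: continuous_subspaceT.
- exists 1; split => // M M1 z _ /=; have /(_ (f z)) := f01.
  rewrite /= in_itv/= => /(_ (ex_intro2 _ _ z I erefl)) /andP[h0 h1].
  by rewrite ger0_norm// (le_trans h1)// ltW.
Qed.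

(** A Urysohn function [f] lies between the indicators of [C] and [G], so [p C] and [q G] are
    compared through its integrals. *)
Lemma continuous_integral_unique (p q : probability B R) :
  (forall f : T -> R, continuous f -> range f `<=` `[0, 1]%classic ->
     \int[p]_z (f z) <= \int[q]_z (f z)) ->
  forall A, measurable A -> p A = q A.
Proof.
move=> pq; apply: probability_closed_open_unique => C G cC oG CG.
have mC := closed_borel cC; have mG := open_borel oG.
have /(@uniform_separatorP _ R)[f [cf f01 f0 f1]] : uniform_separator (~` G) C.
  apply: normal_uniform_separator => //; first exact: pseudometric_normal.
    exact: open_closedC.
  by apply/disjoints_subset; exact: subsetC.
have bf z : 0 <= f z <= 1.
  by have /(_ (f z)) := f01; rewrite /= in_itv/=; apply; exists z.
have intf r := continuous01_integrable r cf f01.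
have inti (r : probability B R) A : measurable A ->
    r.-integrable setT (EFin \o \1_(A : set B)).
  by move=> mA; exact: integrable_indic.
have Ri (r : probability B R) A : measurable A -> r A = (\int[r]_z \1_A z)%:E.
  move=> mA; rewrite /Rintegral integral_indic// setIT fineK//.
  exact: fin_num_measure.
rewrite !Ri// lee_fin.
apply: (@le_trans _ _ (\int[p]_z f z)).
  apply: le_Rintegral; [by []|exact: inti|exact: intf|move=> z _].
  rewrite indicE; have [|_] := boolP (z \in C); last by case/andP: (bf z).
  by rewrite inE => Cz; rewrite (f1 (f z))//; exists z.
apply: (@le_trans _ _ (\int[q]_z f z)); first exact: pq.
apply: le_Rintegral; [by []|exact: intf|exact: inti|move=> z _].
rewrite indicE; have [_|] := boolP (z \in G); first by case/andP: (bf z).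
by rewrite notin_setE => Gz; rewrite (f0 (f z))//; exists z.
Qed.

End borel_probability.

(** * Images of measures under continuous maps *)

Section continuous_pushforward.
Context {R : realType} {T T' : normedModType R}.
Local Notation B := (g_sigma_algebraType (@open T)).
Local Notation B' := (g_sigma_algebraType (@open T')).

Lemma continuous_borel (f : T -> T') : continuous f ->
  measurable_fun [set: B] (f : B -> B').
Proof.
move=> /continuousP cf; apply: (measurability (@open T' : set (set B')) erefl).
by move=> _ [V oV <-]; rewrite setTI; apply: open_borel; exact: cf.
Qed.

Lemma continuous_image_probability (p : probability B R) (f : T -> T') :
  continuous f -> exists q : probability B' R,
    (forall A, q A = p (f @^-1` A)) /\
    forall (K : set B') (h : T' -> R), measurable K ->
      measurable_fun K (h : B' -> R) ->
      p.-integrable (f @^-1` K : set B) (fun z => (h (f z))%:E) ->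
      (\int[q]_(y in K) (h y)%:E = \int[p]_(z in f @^-1` K) (h (f z))%:E)%E.
Proof.
move=> cf; have mf := continuous_borel cf.
pose f' : {mfun B >-> B'} :=
  HB.pack (f : B -> B') (isMeasurableFun.Build _ _ B B' f mf).
exists (distribution p f'); split=> // K h mK mh ih.
(* [h] is only measurable on [K], so it is extended by 0 before the change of variables. *)
have mhK : measurable_fun setT (((EFin \o h) \_ K) : B' -> \bar R).
  by apply/(measurable_restrictT _ mK); exact/measurable_EFinP.
have hE z : (f @^-1` K) z -> ((EFin \o h) \_ K) (f z) = (h (f z))%:E.
  by move=> Kz; rewrite patchT// inE.
have mfK : measurable (f @^-1` K : set B).
  by rewrite -[X in measurable X]setTI; exact: (continuous_borel cf).
transitivity (\int[distribution p f']_(y in K) ((EFin \o h) \_ K) y)%E.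
  by apply: eq_integral => y Ky; rewrite patchT.
rewrite integral_pushforward//.
  by apply: eq_integral => z; rewrite inE => Kz /=; exact: hE.
apply: (eq_integrable mfK (fun z => (h (f z))%:E)); last exact: ih.
by move=> z; rewrite inE => Kz /=; rewrite hE.
Qed.

End continuous_pushforward.

(** * Charges *)

(** Proof irrelevance identifies the packed axioms. This is needed because [F] takes packed charges,
    not set functions, as arguments. *)
Lemma charge_eq d (T : measurableType d) (R : realType)
    (nu1 nu2 : {charge set T -> \bar R}) :
  (nu1 : set T -> \bar R) = nu2 -> nu1 = nu2.
Proof.
case: nu1 => f1 [[a1] [b1] [c1]] ; case: nu2 => f2 [[a2] [b2] [c2]] /= E.
move: a1 b1 c1; rewrite E => a1 b1 c1.
rewrite (Prop_irrelevance a1 a2) (Prop_irrelevance b1 b2).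
by rewrite (Prop_irrelevance c1 c2).
Qed.

Lemma probability_mixture d (T : measurableType d) (R : realType)
    (p q : probability T R) (t : R) : 0 < t < 1 ->
  exists r : probability T R,
    (forall A, r A = t%:E * p A + (1 - t)%:E * q A)%E /\
    forall (D : set T) (f : T -> R), measurable D ->
      p.-integrable D (EFin \o f) -> q.-integrable D (EFin \o f) ->
      \int[r]_(z in D) f z =
        t * \int[p]_(z in D) f z + (1 - t) * \int[q]_(z in D) f z.
Proof.
case/andP=> t0 t1; have t1' : 0 <= 1 - t by lra.
pose tn := NngNum (ltW t0); pose sn := NngNum t1'.
pose M : {measure set T -> \bar R} := measure_add (mscale tn p) (mscale sn q).
have ME A : M A = (t%:E * p A + (1 - t)%:E * q A)%E by exact: measure_addE.
have MT : M setT = 1%E.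
  by rewrite ME !probability_setT !mule1 -EFinD addrC subrK.
have [r rM] := measure_probability MT.
have rE A : r A = (t%:E * p A + (1 - t)%:E * q A)%E by rewrite -ME -rM.
exists r; split=> // D f mD ip iq.
have mf : measurable_fun D (EFin \o f) by case/integrableP : ip.
(* Nonnegative functions first; integrability then makes the integrals of the positive and negative
   parts finite, so that they can be subtracted. *)
have ge0 g : measurable_fun D g -> (forall x, D x -> (0 <= g x)%E) ->
    (\int[r]_(z in D) g z =
      t%:E * \int[p]_(z in D) g z + (1 - t)%:E * \int[q]_(z in D) g z)%E.
  move=> mg g0; rewrite -(ge0_integral_mscale p mD tn)//.
  rewrite -(ge0_integral_mscale q mD sn)//.
  rewrite -ge0_integral_measure_add//; apply: eq_measure_integral => A _ _.
  exact: (congr1 (fun g : set T -> \bar R => g A) rM).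
have pf := integrable_fin_num mD (integrable_funepos mD ip).
have pg := integrable_fin_num mD (integrable_funeneg mD ip).
have qf := integrable_fin_num mD (integrable_funepos mD iq).
have qg := integrable_fin_num mD (integrable_funeneg mD iq).
rewrite /Rintegral [in LHS]integralE [X in _ = _ * fine X + _]integralE.
rewrite [X in _ = _ + _ * fine X]integralE.
rewrite !ge0//; [|exact: measurable_funeneg|exact: measurable_funepos].
rewrite -(fineK pf) -(fineK pg) -(fineK qf) -(fineK qg) /=.
by ring.
Qed.

Section charges.
Context {R : realType} {D : nat}.
Implicit Types (p q r : probability (BXY R D) R) (X Y : set 'rV[R]_D).

(** The negative set of any Hahn decomposition is null for a nonnegative measure, so the Jordan
    parts are [p] and 0. *)
Lemma cint_chg p (A : set (BXY R D)) (h : 'rV[R]_D * 'rV[R]_D -> R) :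
  measurable A ->
  cint (chg p) A h = (\int[p]_(z in A) (h z)%:E)%E.
Proof.
move=> mA; rewrite /cint.
have [[mP _] [mN negN] PN _] := proj2_sig (hahn_of (chg p)).
have N0 (E : set (BXY R D)) : measurable E ->
    p (E `&` (sval (hahn_of (chg p))).2) = 0%E.
  move=> mE; apply/eqP; rewrite eq_le measure_ge0 andbT.
  by apply: (negN (E `&` _)); [exact: measurableI|exact: subIsetr].
rewrite [X in (X - _)%E](@eq_measure_integral _ _ _ A p) => [|E mE _].
  rewrite [X in (_ - X)%E](@eq_measure_integral _ _ _ A mzero) => [|E mE _].
    by rewrite integral_measure_zero sube0.
  rewrite [LHS]jordan_negE [LHS]cjordan_negE /crestr0 mem_set// /crestr.
  by rewrite [X in (- X)%E](N0 _ mE) oppe0.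
rewrite [LHS]jordan_posE [LHS]cjordan_posE /crestr0 mem_set// /crestr.
change (p (E `&` (sval (hahn_of (chg p))).1) = p E).
have mEP := measurableI _ _ mE mP; have mEN := measurableI _ _ mE mN.
have pE : p E = p ((E `&` (sval (hahn_of (chg p))).1) `|`
                  (E `&` (sval (hahn_of (chg p))).2)).
  by rewrite -setIUr PN setIT.
apply/eqP; rewrite eq_le; apply/andP; split.
  by apply: le_measure; rewrite ?inE.
rewrite pE (le_trans (measureU2 _ mEP mEN))//.
by rewrite [X in (_ + X)%E](N0 _ mE) adde0.
Qed.

Lemma inM_chg p X Y : measurable (X `*` Y : set (BXY R D)) ->
  p (X `*` Y) = 1%E -> inM X Y (chg p).
Proof.
move=> mXY p1 A mA AXY; apply/eqP.
change (p A == 0%E); rewrite eq_le measure_ge0 andbT.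
have -> : 0%E = p (~` (X `*` Y)) by rewrite probability_setC// p1 subee.
by apply: le_measure; rewrite ?inE//; exact: measurableC.
Qed.

Lemma chg_mixture p q r (t : R) :
  (forall A, r A = t%:E * p A + (1 - t)%:E * q A)%E ->
  chg r = cadd (cscale t (chg p)) (cscale (1 - t) (chg q)).
Proof. by move=> rE; apply: charge_eq; apply/funext => A; exact: rE. Qed.

(** The superlevel set of [F] contains a weak-* neighbourhood of [chg p] given by finitely many test
    functions, and each of these conditions holds eventually along [U]. *)
Lemma wstar_lsc_limit X Y (F : {charge set BXY R D -> \bar R} -> \bar R)
    (U : set_system (probability (BXY R D) R)) p (c : R) :
  compact X -> compact Y -> wstar_lsc X Y F -> Filter U ->
  p (X `*` Y) = 1%E -> U [set q | q (X `*` Y) = 1%E] ->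
  (forall (h : 'rV[R]_D * 'rV[R]_D -> R) (e : R),
     {within X `*` Y, continuous h} -> 0 < e ->
     U [set q | `|\int[q]_(z in (X `*` Y : set (BXY R D))) h z -
                 \int[p]_(z in (X `*` Y : set (BXY R D))) h z| < e]) ->
  (c%:E < F (chg p))%E -> U [set q | (c%:E < F (chg q))%E].
Proof.
move=> cX cY lsc UU p1 U1 Uh cF.
have cXY := compact_setX cX cY.
have mXY := compact_borel cXY.
have [n [hs [e [e0 chs hU]]]] := lsc c _ (inM_chg mXY p1) cF.
have Uhs := filter_forall _ (fun i => Uh (hs i) e (chs i) e0).
apply: filterS2 U1 (Uhs UU) => q q1 hq; apply: hU => [|i]; first exact: inM_chg.
have cintE (q' : probability (BXY R D) R) : cint (chg q') (X `*` Y) (hs i) =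
    (\int[q']_(z in (X `*` Y : set (BXY R D))) hs i z)%:E.
  rewrite cint_chg// fineK//; apply: integrable_fin_num => //.
  exact: within_continuous_integrable.
by rewrite !cintE -EFinB lte_fin; exact: hq.
Qed.

End charges.

(** * Strong duality *)

Lemma Rintegral_full d (T : measurableType d) (R : realType)
    (p : probability T R) (K : set T) (h : T -> R) :
  measurable K -> p K = 1%E ->
  p.-integrable setT (EFin \o h) -> \int[p]_z h z = \int[p]_(z in K) h z.
Proof.
move=> mK pK ih; congr fine.
rewrite (negligible_integral (measurableC mK) measurableT ih) ?setTD ?setCK//.
have := probability_setC p mK; rewrite pK subee//; exact.
Qed.

Lemma within_continuous_snd (R : realType) (T T' : normedModType R) (X : set T)
    (Y : set T') (v : T' -> R) :
  {within Y, continuous v} -> {within X `*` Y, continuous (fun z => v z.2)}.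
Proof.
move=> /subspace_continuousP cv; apply/subspace_continuousP => z [Xz Yz].
apply: cvg_trans (cv _ Yz) => N /= vN.
have {}vN : \forall w \near z.2, Y w -> N (v w) by exact: vN.
have sndz : snd @ z --> z.2 by exact: cvg_snd.
change (nbhs z [set w : T * T' | (X `*` Y) w -> N (v w.2)]).
have : nbhs z [set w : T * T' | Y w.2 -> N (v w.2)] by exact: sndz vN.
by apply: filterS => w /= h [_ Yw]; exact: h.
Qed.

Section coupling.
Context {R : realType} {D : nat}.
Variables (X Y : set 'rV[R]_D) (P Q : probability (BX R D) R).
Variable F : {charge set BXY R D -> \bar R} -> \bar R.
Hypotheses (cX : compact X) (cY : compact Y) (QY : Q (Y : set (BX R D)) = 1%E).

Let K : set (BXY R D) := X `*` Y.
Let cK : compact (X `*` Y) := compact_setX cX cY.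
Let mK : measurable K := compact_borel cK.

(** The Lagrangian as a real number, meaningful where [F] is finite; the minimax alternative is
    about real functions. *)
Let phi (v : 'rV[R]_D -> R) (p : probability (BXY R D) R) : R :=
  fine (F (chg p)) - \int[p]_(z in K) v z.2
    + \int[Q]_(y in (Y : set (BX R D))) v y.

Let int_snd (p : probability (BXY R D) R) (v : 'rV[R]_D -> R) :
  {within Y, continuous v} -> p.-integrable K (EFin \o (fun z => v z.2)).
Proof.
move=> cv; apply: (within_continuous_integrable p cK).
exact: within_continuous_snd.
Qed.

Let int_Q (v : 'rV[R]_D -> R) : {within Y, continuous v} ->
  Q.-integrable (Y : set (BX R D)) (EFin \o v).
Proof. exact: within_continuous_integrable. Qed.

Lemma LagE v (p : probability (BXY R D) R) : {within Y, continuous v} ->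
  F (chg p) \is a fin_num -> Lag X Y F Q v p = (phi v p)%:E.
Proof.
move=> cv Fp; rewrite /Lag /phi EFinD EFinB /Rintegral !fineK//.
- exact: (integrable_fin_num (compact_borel cY) (int_Q cv)).
- exact: (integrable_fin_num mK (int_snd p cv)).
Qed.

Lemma Lag_pinfty v (p : probability (BXY R D) R) : {within Y, continuous v} ->
  F (chg p) = +oo%E -> Lag X Y F Q v p = +oo%E.
Proof.
move=> cv Fp; rewrite /Lag Fp.
have /fineK <- := integrable_fin_num mK (int_snd p cv).
by have /fineK <- := integrable_fin_num (compact_borel cY) (int_Q cv).
Qed.

Lemma Lag_coupling v (p : probability (BXY R D) R) : {within Y, continuous v} ->
  F (chg p) \is a fin_num -> PiPQ X Y P Q p -> Lag X Y F Q v p = F (chg p).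
Proof.
move=> cv Fp [[pK _] pQ].
have sndc : continuous (snd : 'rV[R]_D * 'rV[R]_D -> 'rV[R]_D).
  by move=> z; exact: cvg_snd.
have mY : measurable (Y : set (BX R D)) := compact_borel cY.
have [q [qE qint]] := continuous_image_probability p sndc.
have mv := within_continuous_measurable mY cv.
have msY : measurable (snd @^-1` Y : set (BXY R D)).
  by rewrite -[X in measurable X]setTI; exact: (continuous_borel sndc).
have iv : p.-integrable (snd @^-1` Y : set (BXY R D)) (fun z => (v z.2)%:E).
  apply: measurable_bounded_integrable => //.
  - by rewrite -ge0_fin_numE// fin_num_measure.
  - apply: (measurable_comp mY) mv _; first by move=> _ [z Yz <-].
    exact: (measurable_funTS (continuous_borel sndc)).
  - have /compact_bounded[M [_ mrt]] := continuous_compact cv cY.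
    exists M; split; rewrite ?num_real // => M' MM' z Yz; apply: mrt MM' _ _.
    by exists z.2.
(* The change of variables integrates over the whole strip above [Y], which differs from [K] by a
   null set. *)
have KY : K = (snd @^-1` Y) `\` ~` K.
  by rewrite setDE setCK; apply/seteqP; split=> [z [Xz Yz]|z []].
have pKC : p (~` K) = 0%E by rewrite probability_setC// pK subee.
have Qint : (\int[Q]_(y in (Y : set (BX R D))) (v y)%:E =
    \int[p]_(z in K) (v z.2)%:E)%E.
  rewrite (@eq_measure_integral _ _ _ _ q) => [|A mA _].
    rewrite qint// (negligible_integral (measurableC mK) msY iv pKC).
    by congr (integral _ _ _); exact/esym.
  rewrite [RHS]qE [LHS](esym (pQ _ mA)); congr (p _).
  by apply/seteqP; split=> [z []|z].
by rewrite LagE// /phi /Rintegral Qint subrK fineK.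
Qed.

Hypothesis Fny : forall nu, inM X Y nu -> (-oo < F nu)%E.
Hypotheses (Fcvx : convex_on_M X Y F) (Flsc : wstar_lsc X Y F).

Let S : set (probability (BXY R D) R) :=
  [set p | PiP X Y P p /\ (F (chg p) < +oo)%E].

Let S_fin p : S p -> F (chg p) \is a fin_num.
Proof.
by move=> [[pK _] Fp]; rewrite fin_real// Fp andbT; apply: Fny; exact: inM_chg.
Qed.

Let W : set ('rV[R]_D -> R) := [set v | {within Y, continuous v}].

Let W_convex v w t : W v -> W w -> 0 <= t <= 1 ->
  exists2 u, W u & forall p, phi u p = t * phi v p + (1 - t) * phi w p.
Proof.
move=> cv cw _; exists (fun y => t * v y + (1 - t) * w y) => [y|p].
  by apply: cvgD; apply: cvgMr; [exact: cv|exact: cw].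
have ip := int_snd p cv; have ip' := int_snd p cw.
have iq := int_Q cv; have iq' := int_Q cw.
have mY : measurable (Y : set (BX R D)) := compact_borel cY.
rewrite /phi !RintegralD//.
- rewrite !RintegralZl//; ring.
- exact: (integrableZl mY t iq).
- exact: (integrableZl mY (1 - t) iq').
- exact: (integrableZl mK t ip).
- exact: (integrableZl mK (1 - t) ip').
Qed.

(** The mixture of [p] and [q] serves all potentials at once: the integral terms are affine in the
    plan and [F] is convex. *)
Let phi_convex p q t : S p -> S q -> 0 < t < 1 ->
  exists2 r, S r & forall v, W v -> phi v r <= t * phi v p + (1 - t) * phi v q.
Proof.
move=> Sp Sq t01; have [r [rE rint]] := probability_mixture p q t01.
have [Fp Fq] := (S_fin Sp, S_fin Sq).
have [[[pK pP] _] [[qK qP] _]] := (Sp, Sq).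
have tt : (t%:E + (1 - t)%:E = 1)%E by rewrite -EFinD addrC subrK.
have rPi : PiP X Y P r.
  split=> [|A mA]; first by rewrite rE pK qK !mule1.
  rewrite rE pP// qP// -ge0_muleDl ?tt ?mul1e// lee_fin; lra.
have := Fcvx (inM_chg mK pK) (inM_chg mK qK) t01.
rewrite -(chg_mixture rE) -(fineK Fp) -(fineK Fq) -!EFinM -EFinD => Fr.
have Sr : S r by split=> //; exact: le_lt_trans Fr (ltry _).
exists r => // v cv; rewrite /phi rint//; [|exact: int_snd|exact: int_snd].
move: Fr; rewrite -(fineK (S_fin Sr)) lee_fin.
set i1 := Rintegral _ _ _; set i2 := Rintegral _ _ _; set i3 := Rintegral _ _ _.
by lra.
Qed.

(** Otherwise the alternative yields a single potential whose Lagrangian is at least [a] on [S]. For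
    plans in [Pi(P)] outside [S] it is [+oo], so this contradicts the hypothesis. *)
Lemma finite_potentials (a : R) (l : seq ('rV[R]_D -> R)) :
  (forall v, {within Y, continuous v} ->
     exists2 p, PiP X Y P p & (Lag X Y F Q v p < a%:E)%E) ->
  {subset l <= W} -> exists2 p, S p & {in l, forall v, phi v p < a}.
Proof.
move=> Lag_a lW; apply: contrapT => nS.
have W0 : W !=set0 by exists (fun=> 0); move=> y; exact: cvg_cst.
have [v Wv av] := convexlike_alt W0 lW W_convex phi_convex nS.
have [p pPi] := Lag_a v Wv; apply/negP; rewrite -leNgt.
have [Fp|] := eqVneq (F (chg p)) +oo%E; first by rewrite Lag_pinfty// leey.
rewrite -ltey => Fp; have Sp : S p by [].
by rewrite LagE ?S_fin// lee_fin av.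
Qed.

(** Strong duality in contrapositive form: a level [a] exceeding the dual value of every potential
    is at least the cost. *)
Lemma coupling_of_potentials (a : R) :
  (forall v, {within Y, continuous v} ->
     exists2 p, PiP X Y P p & (Lag X Y F Q v p < a%:E)%E) ->
  exists2 p, PiPQ X Y P Q p & (F (chg p) <= a%:E)%E.
Proof.
move=> Lag_a.
pose Z (l : seq ('rV[R]_D -> R)) :=
  S `&` [set p | {in l, forall v, phi v p < a}].
have ZF : ProperFilter
    (filter_from [set l : seq ('rV[R]_D -> R) | {subset l <= W}] Z).
  apply: filter_from_proper; last first.
    by move=> l lW; have [p Sp pa] := finite_potentials Lag_a lW; exists p.
  apply: filter_from_filter; first by exists [::].
  move=> l l' lW l'W; exists (l ++ l').
    by move=> v; rewrite mem_cat => /orP[/lW|/l'W].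
  move=> p [Sp pa]; split; split=> // v vl; apply: pa.
    by rewrite mem_cat vl.
  by rewrite mem_cat vl orbT.
have [U [UU ZU]] := ultraFilterLemma ZF.
have US : U S by apply: ZU; exists [::] => // p [].
have UK : U [set p | p K = 1%E] by apply: filterS US => p [[]].
have Uphi v : W v -> U [set p | phi v p < a].
  move=> Wv; apply: ZU; exists [:: v].
    by move=> w; rewrite inE => /eqP ->; rewrite inE.
  by move=> p [_]; apply; rewrite mem_head.
have [p [pK pG]] := ultra_portmanteau UU cK UK.
have UP : ProperFilter U by exact: ultra_proper.
have UF : Filter U by exact: filter_filter.
have Ulim := Rintegral_limit UP cK pK UK pG.
have mY : measurable (Y : set (BX R D)) := compact_borel cY.
(* The constraint [phi v < a] in the limit: lower semi-continuity keeps [F] above [c], and the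
   integral of [v] converges. *)
have bound (c : R) v : W v -> (c%:E < F (chg p))%E ->
    c - \int[p]_(z in K) v z.2 + \int[Q]_(y in (Y : set (BX R D))) v y <= a.
  move=> Wv cF; apply/ler_addgt0Pr => e e0.
  have Uc := wstar_lsc_limit cX cY Flsc UF pK UK Ulim cF.
  have Ui := Ulim _ _ (within_continuous_snd (X := X) Wv) e0.
  have [q [[Sq cq] [vq iq]]] :=
    filter_ex (filterI (filterI US Uc) (filterI (Uphi v Wv) Ui)).
  move: cq vq iq; rewrite /= /phi -(fineK (S_fin Sq)) lte_fin ltr_norml.
  by move=> cq vq /andP[_ iq]; lra.
(* [F (chg p)] may still be [+oo] here; a real number below it takes its place. *)
have [c0 c0F] : exists c : R, (c%:E < F (chg p))%E.
  have := Fny (inM_chg mK pK); case: (F (chg p)) => [r _||//].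
    by exists (r - 1); rewrite lte_fin; lra.
  by exists 0; rewrite ltry.
have int_eq v : W v ->
    \int[p]_(z in K) v z.2 = \int[Q]_(y in (Y : set (BX R D))) v y.
  move=> Wv; set I := LHS; set J := RHS.
  have tb t : c0 - t * I + t * J <= a.
    have Wtv : W (fun y => t * v y) by move=> y; apply: cvgMr; exact: Wv.
    have := bound c0 _ Wtv c0F.
    by rewrite (RintegralZl t mK (int_snd p Wv)) (RintegralZl t mY (int_Q Wv)).
  have [//|IJ] := eqVneq I J.
  have JI : J - I != 0 by rewrite subr_eq0 eq_sym.
  (* This multiple is chosen to raise the left side of the bound to [a + 1]. *)
  have := tb ((a - c0 + 1) / (J - I)).
  have -> : c0 - (a - c0 + 1) / (J - I) * I + (a - c0 + 1) / (J - I) * J =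
      a + 1.
    by field.
  by lra.
(* Every plan in [S] has first marginal [P], so the portmanteau inequality bounds the first marginal
   of [p] by [P] on open sets, and this determines it. *)
have pP : PiP X Y P p.
  have fstc : continuous (fst : 'rV[R]_D * 'rV[R]_D -> 'rV[R]_D).
    by move=> z; exact: cvg_fst.
  have [q1 [q1E _]] := continuous_image_probability p fstc.
  have fstE (A : set (BX R D)) : A `*` setT = fst @^-1` A :> set (BXY R D).
    by apply/seteqP; split=> [z []|z].
  split=> // A mA; rewrite fstE -q1E.
  apply: probability_closed_open_unique A mA => C G cC oG CG.
  have oGT : open (G `*` setT : set ('rV[R]_D * 'rV[R]_D)).
    by rewrite fstE; move/continuousP : fstc; exact.
  have mG := open_borel oG; have mGT := open_borel oGT.
  apply: (@le_trans _ _ (q1 G)).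
    by apply: le_measure; rewrite ?inE//; exact: closed_borel.
  apply/lee_addgt0Pr => e e0; rewrite q1E -fstE.
  have [q [[[_ qP] _]]] := filter_ex (filterI US (pG _ _ oGT e0)).
  rewrite /= qP// -(fineK (fin_num_measure p _ mGT)).
  rewrite -(fineK (fin_num_measure P _ mG)).
  by rewrite -EFinD lee_fin.
have sndc : continuous (snd : 'rV[R]_D * 'rV[R]_D -> 'rV[R]_D).
  by move=> z; exact: cvg_snd.
have [q2 [q2E q2int]] := continuous_image_probability p sndc.
exists p; last first.
  (* For the zero potential, [bound] reads [c <= a]. *)
  rewrite leNgt; apply/negP => aF.
  have [c ac cF] : exists2 c : R, a < c & (c%:E < F (chg p))%E.
    move: aF; case: (F (chg p)) => [r|_|//].
      by rewrite lte_fin => ar; exists ((a + r) / 2); rewrite ?lte_fin; lra.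
    by exists (a + 1); rewrite ?ltry//; lra.
  have W0 : W (fun=> 0) by move=> y; exact: cvg_cst.
  by have := bound c _ W0 cF; rewrite (int_eq _ W0); lra.
split=> // A mA.
have sndE : setT `*` A = snd @^-1` A :> set (BXY R D).
  by apply/seteqP; split=> [z []|z].
rewrite sndE -q2E; apply: (continuous_integral_unique _ mA) => f cf f01.
have fW : W f by exact: continuous_subspaceT.
have ifp : p.-integrable setT (EFin \o (fun z => f z.2)).
  apply: (@continuous01_integrable R ('rV[R]_D * 'rV[R]_D)%type p
    (fun z => f z.2)).
    by move=> z; apply: continuous_comp; [exact: cvg_snd|exact: cf].
  by move=> _ [z _ <-]; apply: f01; exists z.2.
have ifQ := continuous01_integrable Q cf f01.
rewrite (Rintegral_full mY QY ifQ) -(int_eq f fW) -(Rintegral_full mK pK ifp).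
rewrite /Rintegral q2int ?preimage_setT//.
by apply: within_continuous_measurable => //; exact: continuous_subspaceT.
Qed.

End coupling.

Unset Implicit Arguments.

Theorem theorem2 (R : realType) (D : nat) (X Y : set 'rV[R]_D)
  (P Q : probability (BX R D) R)
  (F : {charge set BXY R D -> \bar R} -> \bar R)
  (vs : 'rV[R]_D -> R) :
  (1 <= D)%N ->
  X = Y -> compact X -> compact Y ->
  P (X : set (BX R D)) = 1%E -> Q (Y : set (BX R D)) = 1%E ->
  (* F : M(X x Y) -> R \cup {+oo} *)
  (forall nu, inM X Y nu -> (-oo < F nu)%E) ->
  convex_on_M X Y F -> wstar_lsc X Y F -> sep_star_increasing X Y F ->
  (exists pi, PiPQ X Y P Q pi /\ (F (chg pi) < +oo)%E) ->
  (* v* is an optimal potential *)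
  {within Y, continuous vs} ->
  (forall v, {within Y, continuous v} ->
     (dual_obj X Y F P Q v <= dual_obj X Y F P Q vs)%E) ->
  forall pis : probability (BXY R D) R,
    PiPQ X Y P Q pis ->
    (forall pi, PiPQ X Y P Q pi -> (F (chg pis) <= F (chg pi))%E) ->
    PiP X Y P pis /\
    forall pi, PiP X Y P pi -> (Lag X Y F Q vs pis <= Lag X Y F Q vs pi)%E.
Proof.
move=> _ _ cX cY _ QY Fny Fcvx Flsc _ [pi0 [pi0PQ Fpi0]] cvs opt.
move=> pis pisPQ pis_min.
have mK := compact_borel (compact_setX cX cY).
have Fpis : F (chg pis) \is a fin_num.
  rewrite fin_real// (le_lt_trans (pis_min _ pi0PQ) Fpi0) andbT.
  by apply: Fny; apply: inM_chg => //; case: pisPQ => [[]].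
split=> [|pi piP]; first by case: pisPQ.
rewrite (Lag_coupling cX cY cvs Fpis pisPQ).
(* Since [pis] is a coupling, its Lagrangian is [F (chg pis)]; what remains is that this does not
   exceed the dual value. *)
apply: (@le_trans _ _ (dual_obj X Y F P Q vs)); last first.
  by apply: ereal_inf_lbound; exists pi.
rewrite leNgt; apply/negP => gap.
have [a [ga aF]] : exists a : R,
    (dual_obj X Y F P Q vs < a%:E)%E /\ (a%:E < F (chg pis))%E.
  move: gap; rewrite -(fineK Fpis); case: (dual_obj X Y F P Q vs) => [r|//|].
    rewrite lte_fin => h; exists ((r + fine (F (chg pis))) / 2).
    by rewrite !lte_fin; lra.
  move=> _; exists (fine (F (chg pis)) - 1).
  by split; [exact: ltNyr|rewrite lte_fin; lra].
(* By optimality of [vs], the dual value of every potential is below [a]; the coupling obtained then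
   has smaller cost than [pis]. *)
have [|p pPQ pa] :=
    coupling_of_potentials cX cY QY Fny Fcvx Flsc (a := a) (P := P).
  move=> v cv.
  have : (dual_obj X Y F P Q v < a%:E)%E := le_lt_trans (opt v cv) ga.
  by move=> /ereal_inf_lt[_ [p pP <-] pa]; exists p.
by have := le_lt_trans pa aF; rewrite ltNge pis_min.
Qed.
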